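(* Every separable two-qubit state satisfies the imaginarity steering inequality: if $\rho_{AB}=\sum_\lambda p(\lambda)\,\rho_\lambda^A\otimes\rho_\lambda^B$, where $p(\lambda)$ is a probability distribution and $\rho_\lambda^A,\rho_\lambda^B$ are density matrices on $\mathbb{C}^2$, then $$I_2(\rho_{AB})\le\sqrt2 .$$
   Context: For a density matrix $\rho$ on $\mathbb{C}^2$ and an orthonormal basis $\{|e_0\rangle,|e_1\rangle\}$, let $\rho_e=(\langle e_i|\rho|e_j\rangle)_{i,j}$. The robustness of imaginarity of $\rho$ in that basis is $\frac12\|\rho_e-\rho_e^T\|_1$, where $T$ is the transpose and $\|V\|_1=\operatorname{Tr}\sqrt{V^\dagger V}$. $\mathscr{I}_R^x$ denotes this quantity in the $x$-basis $\{(|0\rangle+|1\rangle)/\sqrt2,(|0\rangle-|1\rangle)/\sqrt2\}$, and $\mathscr{I}_R^y$ denotes it in the $y$-basis $\{(|0\rangle+i|1\rangle)/\sqrt2,(|0\rangle-i|1\rangle)/\sqrt2\}$. For a two-qubit state $\rho_{AB}$ on $\mathbb{C}^2\otimes\mathbb{C}^2$ (Alice's qubit first, Bob's second), $A\in\{x,y\}$ and $a=\pm$, let $\Pi_{\pm|A}=\frac12(\mathbb{1}_2\pm\sigma_A)$ with $\sigma_x,\sigma_y$ the Pauli matrices, $p(a|A)=\operatorname{Tr}[(\Pi_{a|A}\otimes\mathbb{1}_2)\rho_{AB}]$, and $\rho_{a|A}=\operatorname{Tr}_A[(\Pi_{a|A}\otimes\mathbb{1}_2)\rho_{AB}]/p(a|A)$.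 Define $$I_2(\rho_{AB})=\sum_{a=\pm}p(a|y)\,\mathscr{I}_R^x(\rho_{a|y})+\sum_{a=\pm}p(a|x)\,\mathscr{I}_R^y(\rho_{a|x}),$$ with terms having $p(a|A)=0$ taken to be $0$. The imaginarity steering inequality is $I_2(\rho_{AB})\le\sqrt2$. *)

(* Defs.v *)
From HB Require Import structures.
From mathcomp Require Import all_boot all_order all_algebra.
From mathcomp Require Import reals.
From mathcomp Require Export complex mxtens.

Set Implicit Arguments.
Unset Strict Implicit.
Unset Printing Implicit Defensive.

Import Order.TTheory GRing.Theory Num.Theory.
Local Open Scope ring_scope.

(* Everything is stated over an arbitrary numClosedFieldType C, to be
   instantiated with R[i].  Its order is partial: x <= y means that y - x is a
   nonnegative real, so that x <= y with y real also says that x is real. *)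

Section Matrices.
Variable C : numClosedFieldType.

Definition dagger m n (A : 'M[C]_(m, n)) : 'M[C]_(n, m) :=
  map_mx Num.conj (A^T).

Definition psdmx n (A : 'M[C]_n) : Prop :=
  A = dagger A /\ forall v : 'cV[C]_n, 0 <= (dagger v *m A *m v) 0 0.

Definition density n (rho : 'M[C]_n) : Prop := psdmx rho /\ \tr rho = 1.

(* Square root by functional calculus on the spectral decomposition
   A = U^-1 diag(d) U of a normal matrix.  For positive semidefinite A it is
   the positive semidefinite square root: see sqrtmxK and sqrtmx_psd. *)
Definition sqrtmx n (A : 'M[C]_n) : 'M[C]_n :=
  invmx (spectralmx A) *m diag_mx (map_mx sqrtC (spectral_diag A))
    *m spectralmx A.

Definition trnorm n (V : 'M[C]_n) : C := \tr (sqrtmx (dagger V *m V)).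

Lemma daggerM m n p (A : 'M[C]_(m, n)) (B : 'M[C]_(n, p)) :
  dagger (A *m B) = dagger B *m dagger A.
Proof. by rewrite /dagger trmx_mul map_mxM. Qed.

Lemma daggerK m n (A : 'M[C]_(m, n)) : dagger (dagger A) = A.
Proof. by apply/matrixP => i j; rewrite !mxE conjCK. Qed.

Lemma invmx_spectral n (A : 'M[C]_n) :
  invmx (spectralmx A) = dagger (spectralmx A).
Proof. by rewrite invmx_unitary ?spectral_unitarymx // /dagger map_trmx. Qed.

Lemma psdmx_spectral n (A : 'M[C]_n) : psdmx A ->
  A = invmx (spectralmx A) *m diag_mx (spectral_diag A) *m spectralmx A.
Proof.
case=> hA _; apply/orthomx_spectralP/normalmxP.
suff -> : map_mx Num.conj A^T = A by [].
by rewrite -/(dagger A) -hA.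
Qed.

Lemma psdmx_spectral_ge0 n (A : 'M[C]_n) i :
  psdmx A -> 0 <= spectral_diag A 0 i.
Proof.
move=> pA; have := pA.2 (dagger (spectralmx A) *m delta_mx i 0).
rewrite [X in _ *m X *m _](psdmx_spectral pA) daggerM daggerK -!mulmxA.
rewrite -!invmx_spectral !mulKVmx ?spectral_unit //.
rewrite mulmxA.
have -> : dagger (delta_mx i 0 : 'cV[C]_n) = delta_mx 0 i.
  by rewrite /dagger trmx_delta map_delta_mx.
by rewrite -rowE -colE !mxE eqxx mulr1n.
Qed.

Lemma sqrtmxK n (A : 'M[C]_n) : psdmx A -> sqrtmx A *m sqrtmx A = A.
Proof.
move=> pA; rewrite /sqrtmx -!mulmxA mulKVmx ?spectral_unit //.
rewrite [diag_mx _ *m (_ *m _)]mulmxA mulmx_diag mulmxA.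
rewrite [RHS](psdmx_spectral pA); congr (_ *m diag_mx _ *m _).
by apply/rowP => i; rewrite !mxE -expr2 sqrtCK.
Qed.

Lemma sqrtmx_psd n (A : 'M[C]_n) : psdmx A -> psdmx (sqrtmx A).
Proof.
move=> pA; rewrite /sqrtmx invmx_spectral.
set U := spectralmx A; set D := diag_mx _.
have hD : dagger D = D.
  apply/matrixP => i j; rewrite !mxE eq_sym.
  case: eqP => [->|]; rewrite ?mulr0n ?rmorph0 // mulr1n.
  by apply/CrealP/ger0_real; rewrite sqrtC_ge0 psdmx_spectral_ge0.
split=> [|v]; first by rewrite !daggerM daggerK hD mulmxA.
set w := U *m v; have -> : dagger v *m (dagger U *m D *m U) *m v
    = dagger w *m D *m w by rewrite daggerM !mulmxA.
rewrite mxE sumr_ge0 // => i _.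
rewrite mul_mx_diag !mxE mulrAC mulr_ge0 //.
  by rewrite mulrC mul_conjC_ge0.
by rewrite sqrtC_ge0 psdmx_spectral_ge0.
Qed.

Lemma psdmx_gram m n (V : 'M[C]_(m, n)) : psdmx (dagger V *m V).
Proof.
split=> [|v]; first by rewrite daggerM daggerK.
rewrite mulmxA -daggerM -mulmxA mxE sumr_ge0 // => i _.
by rewrite !mxE mulrC mul_conjC_ge0.
Qed.

End Matrices.

Section Imaginarity.
Variable C : numClosedFieldType.

Definition mx_in_basis (e : 'I_2 -> 'cV[C]_2) (rho : 'M[C]_2) : 'M[C]_2 :=
  \matrix_(i, j) (dagger (e i) *m rho *m e j) 0 0.

Definition robustness (e : 'I_2 -> 'cV[C]_2) (rho : 'M[C]_2) : C :=
  2%:R^-1 * trnorm (mx_in_basis e rho - (mx_in_basis e rho)^T).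

Definition ket (i : 'I_2) : 'cV[C]_2 := delta_mx i 0.

Definition xbasis (k : 'I_2) : 'cV[C]_2 :=
  (sqrtC 2%:R)^-1 *: (ket 0 + (-1) ^+ k *: ket 1).

Definition ybasis (k : 'I_2) : 'cV[C]_2 :=
  (sqrtC 2%:R)^-1 *: (ket 0 + ((-1) ^+ k * 'i) *: ket 1).

Definition sigma_x : 'M[C]_2 := delta_mx 0 1 + delta_mx 1 0.
Definition sigma_y : 'M[C]_2 := - 'i *: delta_mx 0 1 + 'i *: delta_mx 1 0.

End Imaginarity.

Section Steering.
Variable C : numClosedFieldType.

(* The basis vector |k>|l> of C^2 (x) C^2 has index mxtens_index (k, l), the
   convention of the Kronecker product *t; Alice's qubit is the first factor. *)
Definition ptrace_A (M : 'M[C]_(2 * 2)) : 'M[C]_2 :=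
  \matrix_(i, j) \sum_(k < 2) M (mxtens_index (k, i)) (mxtens_index (k, j)).

(* Below, sigma is the Pauli matrix of Alice's setting, and the outcome
   a = false, true stands for +, -. *)
Definition proj (sigma : 'M[C]_2) (a : bool) : 'M[C]_2 :=
  2%:R^-1 *: (1%:M + (-1) ^+ a *: sigma).

Definition prob (rho : 'M[C]_(2 * 2)) (sigma : 'M[C]_2) (a : bool) : C :=
  \tr ((proj sigma a *t 1%:M) *m rho).

Definition cond_state (rho : 'M[C]_(2 * 2)) (sigma : 'M[C]_2) (a : bool) :
    'M[C]_2 :=
  (prob rho sigma a)^-1 *: ptrace_A ((proj sigma a *t 1%:M) *m rho).

(* A term with prob rho sigma a = 0 is 0, because of the factor. *)
Definition I2 (rho : 'M[C]_(2 * 2)) : C :=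
  \sum_(a : bool) prob rho (sigma_y C) a
     * robustness (@xbasis C) (cond_state rho (sigma_y C) a)
  + \sum_(a : bool) prob rho (sigma_x C) a
     * robustness (@ybasis C) (cond_state rho (sigma_x C) a).

Definition separable (rho : 'M[C]_(2 * 2)) : Prop :=
  exists (L : finType) (p : L -> C) (rhoA rhoB : L -> 'M[C]_2),
    [/\ forall l, 0 <= p l, \sum_l p l = 1,
        forall l, density (rhoA l) /\ density (rhoB l)
      & rho = \sum_l p l *: (rhoA l *t rhoB l)].

End Steering.

(* Main.v *)
(** For a 2x2 matrix the antisymmetric part in any basis is a multiple of
    [[0,1],[-1,0]], so the robustness is the modulus of one entry difference:
    [|tr (sigma_y rho)|] in the x-basis, [|tr (sigma_x rho)|] in the y-basis.
    These are absolutely homogeneous and subadditive, so the probabilities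
    cancel the normalisations of the conditional states and, for a separable
    state, Alice's weights sum to 1 over her outcomes.  What remains is an
    average over [l] of [|tr (sigma_y rhoB_l)| + |tr (sigma_x rhoB_l)|].  The
    squares of these two moduli add up to [4 |<0|rhoB_l|1>|^2 <= 1], hence the
    sum is at most [sqrt 2]. *)
Require Import Defs.
From mathcomp Require Import all_boot all_order all_algebra.
From mathcomp Require Import reals.
From mathcomp Require Import ring.
Import Order.TTheory GRing.Theory Num.Theory.
Local Open Scope ring_scope.

Section SmallMatrices.
Variable C : numClosedFieldType.

(** * Robustness of imaginarity in closed form *)

Lemma sum_ord2 (F : 'I_2 -> C) : \sum_i F i = F 0 + F 1.
Proof. by rewrite big_ord_recl big_ord1; congr (_ + F _); apply/val_inj. Qed.

Lemma matrix2P (A B : 'M[C]_2) :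
  A 0 0 = B 0 0 -> A 0 1 = B 0 1 -> A 1 0 = B 1 0 -> A 1 1 = B 1 1 -> A = B.
Proof.
move=> e00 e01 e10 e11; apply/matrixP => i j.
have ord2 (k : 'I_2) : k = 0 \/ k = 1.
  by case: k => [[|[|//]] hk]; [left | right]; apply/val_inj.
by case: (ord2 i) => ->; case: (ord2 j) => ->.
Qed.

(** A scalar matrix commutes with its diagonalising matrix, so undoing the conjugation gives the
    scalar matrix back. *)
Lemma spectral_diag_scalar n (c : C) i :
  spectral_diag (c%:M : 'M[C]_n) 0 i = c.
Proof.
set A : 'M[C]_n := c%:M.
have nA : A \is normalmx.
  by apply/normalmxP; rewrite tr_scalar_mx map_scalar_mx /=; exact: scalar_mxC.
have /orthomx_spectralP eA := nA.
have eD : diag_mx (spectral_diag A) = A.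
  have uA := spectral_unit A.
  move/(congr1 (fun M => spectralmx A *m M *m invmx (spectralmx A))): eA.
  rewrite -!mulmxA mulKVmx // mulmxV // mulmx1 mul_scalar_mx -scalemxAr.
  by rewrite mulmxV // scalemx1.
by move/matrixP/(_ i i): eD; rewrite !mxE eqxx !mulr1n.
Qed.

Lemma sqrtmx_scalar n (c : C) :
  sqrtmx (c%:M : 'M[C]_n) = (sqrtC c)%:M.
Proof.
rewrite /sqrtmx.
have -> : map_mx sqrtC (spectral_diag (c%:M : 'M[C]_n)) = const_mx (sqrtC c).
  by apply/rowP => i; rewrite !mxE spectral_diag_scalar.
by rewrite diag_const_mx -mulmxA -scalar_mxC mulKmx ?spectral_unit.
Qed.

(** [M - M^T] is [m] times a rotation by a right angle, so its Gram matrix is the scalar [|m|^2];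
    the root has trace [2|m|], which the factor 1/2 cancels. *)
Lemma robustnessE (e : 'I_2 -> 'cV[C]_2) rho :
  robustness e rho = `|mx_in_basis e rho 0 1 - mx_in_basis e rho 1 0|.
Proof.
rewrite /robustness; move: (mx_in_basis e rho) => M; set m := _ - M 1 0.
have gram : dagger (M - M^T) *m (M - M^T) = (`|m| ^+ 2)%:M.
  by apply: matrix2P; rewrite !mxE sum_ord2 !mxE /= ?mulr1n ?mulr0n ?normCK /m
    ?rmorphB /=; ring.
rewrite /trnorm gram sqrtmx_scalar mxtrace_scalar sqrCK //.
by rewrite -[`|m| *+ 2]mulr_natl mulKf ?pnatr_eq0.
Qed.

Lemma sandwich2E (u v : 'cV[C]_2) (A : 'M[C]_2) :
  (dagger u *m A *m v) 0 0 =
  (u 0 0)^* * (A 0 0 * v 0 0 + A 0 1 * v 1 0)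
  + (u 1 0)^* * (A 1 0 * v 0 0 + A 1 1 * v 1 0).
Proof. by rewrite !mxE sum_ord2 !mxE !sum_ord2 !mxE; ring. Qed.

Lemma inv_sqrt2_real : ((sqrtC (2%:R : C))^-1)^* = (sqrtC 2%:R)^-1.
Proof. by apply/CrealP/ger0_real; rewrite invr_ge0 sqrtC_ge0 ler0n. Qed.

Lemma inv_sqrt2_sqr : (sqrtC (2%:R : C))^-1 ^+ 2 = 2%:R^-1.
Proof. by rewrite exprVn sqrtCK. Qed.

Lemma robustness_xbasis (rho : 'M[C]_2) :
  robustness (@xbasis C) rho = `|\tr (sigma_y C *m rho)|.
Proof.
rewrite robustnessE ![mx_in_basis _ _ _ _]mxE !sandwich2E /mxtrace sum_ord2.
rewrite !mxE !sum_ord2 !mxE /=.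
rewrite !expr0 !expr1 ?mulr1n ?mulr0n; set s := (sqrtC _)^-1.
rewrite !rmorphM !rmorphD !rmorphM ?rmorphN ?rmorph1 ?rmorph0 /=.
rewrite inv_sqrt2_real -/s.
(* The unimodular factor [- 'i] is inserted to match the entries of [sigma_y]. *)
transitivity `|- 'i * (2%:R * s ^+ 2 * (rho 1 0 - rho 0 1))|.
  by rewrite [RHS]normrM normrN normCi [RHS]mul1r; congr (Num.norm _); ring.
by rewrite inv_sqrt2_sqr divff ?pnatr_eq0 // mul1r; congr (Num.norm _); ring.
Qed.

Lemma robustness_ybasis (rho : 'M[C]_2) :
  robustness (@ybasis C) rho = `|\tr (sigma_x C *m rho)|.
Proof.
rewrite robustnessE ![mx_in_basis _ _ _ _]mxE !sandwich2E /mxtrace sum_ord2.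
rewrite !mxE !sum_ord2 !mxE /=.
rewrite !expr0 !expr1 ?mulr1n ?mulr0n; set s := (sqrtC _)^-1.
rewrite !rmorphM !rmorphD !rmorphM ?rmorphN ?rmorph1 ?rmorph0 /= ?conjCi.
rewrite inv_sqrt2_real -/s.
(* Here [- 'i] comes from the basis itself and is dropped by the modulus. *)
transitivity `|- 'i * (2%:R * s ^+ 2 * (rho 1 0 + rho 0 1))|.
  by congr (Num.norm _); ring.
rewrite normrM normrN normCi mul1r inv_sqrt2_sqr divff ?pnatr_eq0 // mul1r.
by congr (Num.norm _); ring.
Qed.

(** * Projectors and positivity of outcome probabilities *)

Lemma mxtrace_conj_ge0 n m (A : 'M[C]_n) (P : 'M_(m, n)) :
  psdmx A -> 0 <= \tr (P *m A *m dagger P).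
Proof.
move=> pA; apply: sumr_ge0 => i _.
have := pA.2 (dagger (row i P)); rewrite daggerK -row_mul.
suff -> : (row i (P *m A) *m dagger (row i P)) 0 0
  = (P *m A *m dagger P) i i by [].
by rewrite !mxE; apply: eq_bigr => k _; rewrite !mxE.
Qed.

Lemma proj_idem (sigma : 'M[C]_2) a :
  sigma *m sigma = 1%:M -> proj sigma a *m proj sigma a = proj sigma a.
Proof.
move=> s2; rewrite /proj -scalemxAl -scalemxAr mulmxDl !mulmxDr !mul1mx mulmx1.
rewrite -scalemxAl -scalemxAr s2 !scalerA -signr_addb addbb expr0 scale1r.
rewrite [in X in _ *: (_ + X)]addrC -mulr2n -scaler_nat scalerA.
by rewrite mulfVK ?pnatr_eq0.
Qed.

Lemma proj_herm (sigma : 'M[C]_2) a :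
  dagger sigma = sigma -> dagger (proj sigma a) = proj sigma a.
Proof.
move=> hs; rewrite /proj /dagger linearZ linearD linearZ /= trmx1.
rewrite map_mxZ map_mxD map_mxZ map_mx1 /= -/(dagger sigma) hs.
by rewrite fmorphV rmorph_nat rmorph_sign.
Qed.

(** A Hermitian idempotent [P] satisfies [tr (P A) = tr (P A P^dagger)] by cyclicity of the
    trace. *)
Lemma proj_ge0 (sigma A : 'M[C]_2) a : dagger sigma = sigma ->
  sigma *m sigma = 1%:M -> psdmx A -> 0 <= \tr (proj sigma a *m A).
Proof.
move=> hs s2 pA; rewrite -(@proj_idem _ a s2) -mulmxA mxtrace_mulC.
by rewrite -{2}(@proj_herm _ a hs) mxtrace_conj_ge0.
Qed.

Lemma sum_proj (sigma : 'M[C]_2) : \sum_(a : bool) proj sigma a = 1%:M.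
Proof.
rewrite big_bool /= /proj -scalerDr expr0 expr1 scale1r scaleN1r.
rewrite addrACA addNr addr0 -mulr2n -scaler_nat scalerA.
by rewrite mulVf ?pnatr_eq0 // scale1r.
Qed.

(** * Bounds on Pauli expectations *)

Lemma offdiag_le_trace (A : 'M[C]_2) : psdmx A -> 2%:R * `|A 0 1| <= \tr A.
Proof.
case=> hA pA.
have e10 : A 1 0 = (A 0 1)^* by rewrite [in LHS]hA !mxE.
(* The phase [z] below needs a nonzero entry; otherwise the claim is just that the trace is
   nonnegative. *)
have [c0|c0] := eqVneq (A 0 1) 0.
  rewrite c0 normr0 mulr0.
  have := @mxtrace_conj_ge0 _ _ _ 1%:M (conj hA pA).
  suff -> : dagger 1%:M = 1%:M :> 'M[C]_2 by rewrite mul1mx mulmx1.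
  by rewrite /dagger trmx1 map_mx1.
have n0 : `|A 0 1| != 0 by rewrite normr_eq0.
(* At (1, z) the quadratic form of A is exactly [\tr A - 2 * `|A 0 1|]. *)
set z := - (A 0 1)^* / `|A 0 1|.
have zc : z^* = - A 0 1 / `|A 0 1|.
  by rewrite /z rmorphM rmorphN /= conjCK fmorphV /= (CrealP (normr_real _)).
have nn : A 0 1 * (A 0 1)^* = `|A 0 1| ^+ 2 by rewrite normCK.
rewrite -subr_ge0; have := pA (\col_i (if i == 0 then 1 else z)).
rewrite sandwich2E !mxE /= rmorph1 e10 zc /mxtrace sum_ord2.
congr (is_true (0 <= _)); rewrite /z.
transitivity (A 0 0 + A 1 1 * (A 0 1 * (A 0 1)^* / `|A 0 1| ^+ 2)
   - 2%:R * (A 0 1 * (A 0 1)^* / `|A 0 1|)); first by field.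
by rewrite nn divff ?expf_neq0 //; field.
Qed.

(** The gap between [2(x^2 + y^2)] and [(x + y)^2] is [(x - y)^2], nonnegative because [x - y] is
    real. *)
Lemma add_le_sqrt2 (x y : C) : 0 <= x -> 0 <= y -> x ^+ 2 + y ^+ 2 <= 1 ->
  x + y <= sqrtC 2%:R.
Proof.
move=> x0 y0 h.
rewrite -(ler_sqr (x := x + y)) ?nnegrE ?addr_ge0 ?sqrtC_ge0 ?ler0n // sqrtCK.
apply: (@le_trans _ _ (2%:R * (x ^+ 2 + y ^+ 2))); last first.
  by rewrite -[leRHS]mulr1 ler_pM2l ?ltr0n.
rewrite -subr_ge0.
have -> : 2%:R * (x ^+ 2 + y ^+ 2) - (x + y) ^+ 2 = (x - y) ^+ 2 by ring.
by rewrite real_exprn_even_ge0 ?rpredB ?ger0_real.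
Qed.

(** With [z = A 0 1] the traces are [-2 Im z] and [2 Re z]. *)
Lemma pauli_xy_le_sqrt2 (A : 'M[C]_2) : density A ->
  `|\tr (sigma_y C *m A)| + `|\tr (sigma_x C *m A)| <= sqrtC 2%:R.
Proof.
move=> [pA trA]; apply: add_le_sqrt2 => //.
have hc := offdiag_le_trace _ pA; rewrite trA in hc.
have e10 : A 1 0 = (A 0 1)^* by rewrite [in LHS]pA.1 !mxE.
suff -> : `|\tr (sigma_y C *m A)| ^+ 2 + `|\tr (sigma_x C *m A)| ^+ 2
    = (2%:R * `|A 0 1|) ^+ 2 by rewrite expr_le1 ?mulr_ge0 ?ler0n.
have -> : \tr (sigma_y C *m A) = 'i * (A 0 1 - (A 0 1)^*).
  by rewrite -e10 /mxtrace !sum_ord2 !mxE !sum_ord2 !mxE /=; ring.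
have -> : \tr (sigma_x C *m A) = A 0 1 + (A 0 1)^*.
  by rewrite -e10 /mxtrace !sum_ord2 !mxE !sum_ord2 !mxE /=; ring.
by rewrite normrM normCi mul1r exprMn !normCK rmorphB rmorphD /= conjCK; ring.
Qed.

End SmallMatrices.

Section Steering.
Variable C : numClosedFieldType.

(** * Partial trace and conditional states *)

Lemma ptrace_A_tens (A B : 'M[C]_2) : ptrace_A (A *t B) = \tr A *: B.
Proof.
apply/matrixP => i j; rewrite !mxE mulr_suml; apply: eq_bigr => k _.
by rewrite tensmxE.
Qed.

Lemma ptrace_A_sum (L : finType) (F : L -> 'M[C]_(2 * 2)) :
  ptrace_A (\sum_l F l) = \sum_l ptrace_A (F l).
Proof.
apply/matrixP => i j; rewrite !mxE summxE.
under eq_bigr do rewrite summxE.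
by rewrite exchange_big; apply: eq_bigr => l _; rewrite mxE.
Qed.

Lemma ptrace_AZ c (M : 'M[C]_(2 * 2)) : ptrace_A (c *: M) = c *: ptrace_A M.
Proof.
apply/matrixP => i j; rewrite !mxE mulr_sumr.
by apply: eq_bigr => k _; rewrite mxE.
Qed.

Lemma mxtrace_ptrace_A (M : 'M[C]_(2 * 2)) : \tr (ptrace_A M) = \tr M.
Proof.
rewrite /mxtrace; under eq_bigr do rewrite mxE.
rewrite exchange_big pair_big.
rewrite (reindex (@mxtens_unindex 2 2)) /=; last first.
  by exists (@mxtens_index 2 2) => x _; rewrite ?mxtens_indexK ?mxtens_unindexK.
by apply: eq_bigr => k _; rewrite mxtens_unindexK.
Qed.

(** One [sigma] suffices in each half of [I2]: the Pauli matrix that Alice measures also expresses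
    Bob's robustness. *)
Lemma steering_term_le (e : 'I_2 -> 'cV[C]_2) (sigma : 'M[C]_2)
    (rho : 'M[C]_(2 * 2)) (L : finType) (p : L -> C)
    (rhoA rhoB : L -> 'M[C]_2) :
  (forall A, robustness e A = `|\tr (sigma *m A)|) ->
  dagger sigma = sigma -> sigma *m sigma = 1%:M ->
  (forall l, 0 <= p l) ->
  (forall l, density (rhoA l) /\ density (rhoB l)) ->
  rho = \sum_l p l *: (rhoA l *t rhoB l) ->
  \sum_(a : bool) prob rho sigma a * robustness e (cond_state rho sigma a)
    <= \sum_l p l * `|\tr (sigma *m rhoB l)|.
Proof.
move=> he hs s2 p0 dens rhoE.
(* Alice's probability of outcome [a] given the hidden label [l]. *)
pose q a l := \tr (proj sigma a *m rhoA l).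
have q0 a l : 0 <= q a l by apply: proj_ge0 => //; case: (dens l) => [[]].
have q1 l : \sum_a q a l = 1.
  rewrite -(raddf_sum (@mxtrace C 2)) -mulmx_suml sum_proj mul1mx.
  exact: (dens l).1.2.
have pt a : ptrace_A ((proj sigma a *t 1%:M) *m rho)
    = \sum_l (p l * q a l) *: rhoB l.
  rewrite rhoE mulmx_sumr ptrace_A_sum; apply: eq_bigr => l _.
  by rewrite -scalemxAr ptrace_AZ tensmx_mul mul1mx ptrace_A_tens scalerA.
have pr a : prob rho sigma a = \sum_l p l * q a l.
  rewrite /prob -mxtrace_ptrace_A pt raddf_sum /=; apply: eq_bigr => l _.
  by rewrite mxtraceZ (dens l).2.2 mulr1.
have pr0 a : 0 <= prob rho sigma a.
  by rewrite pr sumr_ge0 // => l _; rewrite mulr_ge0.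
apply: (@le_trans _ _
  (\sum_(a : bool) \sum_l p l * q a l * `|\tr (sigma *m rhoB l)|)).
  apply: ler_sum => a _; rewrite he /cond_state -scalemxAr mxtraceZ normrM.
  rewrite ger0_norm ?invr_ge0 // mulrA.
  apply: (@le_trans _ _
    `|\tr (sigma *m ptrace_A ((proj sigma a *t 1%:M) *m rho))|).
    (* At probability 0 the left side is 0; aiming only for an inequality avoids showing that the
       unnormalised state vanishes. *)
    have [->|pn0] := eqVneq (prob rho sigma a) 0; first by rewrite !mul0r.
    by rewrite divff // mul1r.
  rewrite pt mulmx_sumr raddf_sum /=; apply: (le_trans (ler_norm_sum _ _ _)).
  apply: ler_sum => l _.
  by rewrite -scalemxAr mxtraceZ normrM ger0_norm // mulr_ge0.
rewrite exchange_big; apply: ler_sum => l _; rewrite -mulr_suml -mulr_sumr.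
by rewrite q1 mulr1.
Qed.

Lemma sigma_x_herm : dagger (sigma_x C) = sigma_x C.
Proof. by apply: matrix2P; rewrite !mxE /= rmorphD rmorph0 ?rmorph1; ring. Qed.

Lemma sigma_y_herm : dagger (sigma_y C) = sigma_y C.
Proof.
by apply: matrix2P; rewrite !mxE /= rmorphD !rmorphM rmorphN /= conjCi
  ?rmorph0 ?rmorph1; ring.
Qed.

Lemma sigma_x_sqr : sigma_x C *m sigma_x C = 1%:M.
Proof. by apply: matrix2P; rewrite !mxE sum_ord2 !mxE /=; ring. Qed.

Lemma sigma_y_sqr : sigma_y C *m sigma_y C = 1%:M.
Proof.
have i2 := sqrCi C.
by apply: matrix2P; rewrite !mxE sum_ord2 !mxE /=; ring: i2.
Qed.

End Steering.

Theorem theorem1 (R : realType) (rho : 'M[R[i]]_(2 * 2)) :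
  separable rho -> I2 rho <= sqrtC (2%:R : R[i]).
Proof.
move=> [L [p [rhoA [rhoB [p0 p1 dens rhoE]]]]]; rewrite /I2.
have steer e sigma he hs s2 :=
  steering_term_le R[i] e sigma rho L p rhoA rhoB he hs s2 p0 dens rhoE.
apply: (le_trans (lerD
  (steer _ _ (robustness_xbasis _) (sigma_y_herm _) (sigma_y_sqr _))
  (steer _ _ (robustness_ybasis _) (sigma_x_herm _) (sigma_x_sqr _)))).
(* The bound is spread over [l] with the weights [p l], to compare term by term. *)
rewrite -big_split /= -[leRHS]mul1r -[X in _ <= X * _]p1 mulr_suml.
apply: ler_sum => l _; rewrite -mulrDr; apply: ler_wpM2l => //.
exact: (pauli_xy_le_sqrt2 _ _ (dens l).2).
Qed.
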